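(* Let $n\ge m$, let $H\in\mathbb{R}^{n\times m}$ and $H+\Delta H\in\mathbb{R}^{n\times m}$ have rank $m$, with singular value decompositions $H=M\Gamma N^t$ and $H+\Delta H=U\Sigma V^t$, with distinct singular values $\gamma_1>\dots>\gamma_m>0$ and $\sigma_1>\dots>\sigma_m>0$ respectively, and let $\epsilon>0$. Let $r$ with $1\le r<m$ be such that, for some $\kappa>1$, the models $\mathbf{y}=H\mathbf{x}+\sqrt{\epsilon}\,\mathbf{n}$ and $\mathbf{y}=(H+\Delta H)\widetilde{\mathbf{x}}+\sqrt{\epsilon}\,\widetilde{\mathbf{n}}$ constitute a corresponding pair of ill-conditioned stochastic linear models with high signal-to-noise ratio of gap $\kappa$ under perturbation $\Delta H$ with this $r$ (definition in the context). For $i=1,\dots,r$ let $$\rho_i=1-\frac{\|\Delta H\|_2^2}{\delta_i^2},\qquad \delta_1=|\sigma_1-\gamma_2|,\qquad \delta_i=\min\{|\sigma_i-\gamma_{i-1}|,\,|\sigma_i-\gamma_{i+1}|\}\ (2\le i\le r),$$ and assume $\rho_i>1/2$ for $i=1,\dots,r$. Put $x_i=\frac{\sigma_i}{\sigma_i^2+\epsilon}$ for $i=1,\dots,m$, and let $k_{i,j}$ and $l_{i,j}$ denote the entries of $K=U^tM\in\mathbb{R}^{n\times n}$ and $L=N^tV\in\mathbb{R}^{m\times m}$. Let $J(\cdot)$ be the mean-square error and $\widetilde W_{MMSE},\widetilde W_{r-MMSE},\widetilde W_{r-SVD}$ the estimators defined in the context, and let $$J^{0}_{r-MMSE}=\sum_{i=1}^r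 x_i^2(\gamma_i^2+\epsilon)-2\sum_{i=1}^r x_i\gamma_i+m,\qquad J^{0}_{r-SVD}=\sum_{i=1}^r\frac{\gamma_i^2+\epsilon}{\sigma_i^2}-2\sum_{i=1}^r\frac{\gamma_i}{\sigma_i}+m .$$ Then $$\left|J(\widetilde W_{r-MMSE})-J^{0}_{r-MMSE}\right|\le 2\sum_{i=1}^r\sum_{j=1}^m(1-\rho_i)(x_i\gamma_j+1)^2,$$ $$\left|J(\widetilde W_{r-SVD})-J^{0}_{r-SVD}\right|\le 2\sum_{i=1}^r\sum_{j=1}^m(1-\rho_i)(\sigma_i^{-1}\gamma_j+1)^2.$$ Moreover, $J(\widetilde W_{MMSE})\ge J(\widetilde W_{r-MMSE})$ if $$\sum_{i=r+1}^m\sum_{j=1}^m(x_i\gamma_jk_{i,j}-l_{j,i})^2+\epsilon\sum_{i=r+1}^m x_i^2\ \ge\ m-r .$$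
   Context: Singular value decompositions: $M,U\in\mathbb{R}^{n\times n}$ and $N,V\in\mathbb{R}^{m\times m}$ are orthogonal, $\Gamma,\Sigma\in\mathbb{R}^{n\times m}$ are (rectangular) diagonal with the singular values on the main diagonal in decreasing order. $\|\cdot\|_2$ is the spectral norm. Model: $\mathbf{y}=H\mathbf{x}+\sqrt{\epsilon}\,\mathbf{n}$, where $\mathbf{x}$ ($\mathbb{R}^m$-valued) and $\mathbf{n}$ ($\mathbb{R}^n$-valued) are zero-mean, uncorrelated random vectors with covariance matrices $I_m$ and $I_n$. For $\widetilde W\in\mathbb{R}^{m\times n}$, the mean-square error is $$J(\widetilde W)=\mathrm{tr}\,\mathbb{E}\left[(\widetilde W\mathbf{y}-\mathbf{x})(\widetilde W\mathbf{y}-\mathbf{x})^t\right]=\mathrm{tr}[\widetilde W(HH^t+\epsilon I_n)\widetilde W^t]-2\,\mathrm{tr}[\widetilde WH]+m .$$ The second (misguided) model $\mathbf{y}=(H+\Delta H)\widetilde{\mathbf{x}}+\sqrt{\epsilon}\,\widetilde{\mathbf{n}}$ uses the perturbed matrix $H+\Delta H$ in place of $H$, with $\widetilde{\mathbf x},\widetilde{\mathbf n}$ assumed zero-mean, uncorrelated, with covariances $I_m$, $I_n$; the estimators are built from it: $\widetilde W_{MMSE}=V\Sigma^t(\Sigma\Sigma^t+\epsilon I_n)^{-1}U^t$; $\widetilde W_{r-MMSE}=VI_m^r\Sigma^t(\Sigma\Sigma^t+\epsilon I_n)^{-1}U^t$; $\widetilde W_{r-SVD}=V\Sigma_r^\dagger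 U^t$. Here $I_m^r\in\mathbb{R}^{m\times m}$ is diagonal with first $r$ diagonal entries $1$ and the others $0$, and $\Sigma_r^\dagger\in\mathbb{R}^{m\times n}$ has $\sigma_1^{-1},\dots,\sigma_r^{-1}$ as its first $r$ main diagonal entries and zeros elsewhere. The quantities $J^0_{r-MMSE}$, $J^0_{r-SVD}$ are the mean-square errors these estimators would have if $H=U\Gamma V^t$. Definition (pairwise separated). $\{\sigma_1,\dots,\sigma_r\}$ and $\{\gamma_1,\dots,\gamma_r\}$ are pairwise separated if $\gamma_r>\|\Delta H\|_2$ and the intervals $[\gamma_i-\|\Delta H\|_2,\ \gamma_i+\sqrt2\|\Delta H\|_2]$, $i=1,\dots,r$, are disjoint. Definition (corresponding pair). The two models constitute a corresponding pair of ill-conditioned stochastic linear models with high signal-to-noise ratio of gap $\kappa>1$ under perturbation $\Delta H$ if for a certain $r$ with $1\le r<m$: (1) $\{\gamma_1,\dots,\gamma_r\}$ and $\{\sigma_1,\dots,\sigma_r\}$ are pairwise separated; (2) $\gamma_1,\dots,\gamma_r$ and $\sigma_1,\dots,\sigma_r$ are all greater than $\kappa\sqrt\epsilon$; (3) $\gamma_{r+1},\dots,\gamma_m$ and $\sigma_{r+1},\dots,\sigma_m$ are all at most $\sqrt\epsilon$. *)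

(* Defs.v *)
From HB Require Import structures.
From mathcomp Require Import all_boot all_order all_algebra.
From mathcomp Require Import all_classical all_reals all_analysis.

Set Implicit Arguments.
Unset Strict Implicit.
Unset Printing Implicit Defensive.

Import Order.TTheory GRing.Theory Num.Theory.

Local Open Scope classical_set_scope.
Local Open Scope ring_scope.

(* Conventions: singular values are sequences s : nat -> R indexed from 0, so
   that s i is the (i+1)-st singular value; only the values s i with i below
   the number of singular values are ever constrained or used. *)

Definition orthogonal_mx (R : pzRingType) (k : nat) (A : 'M[R]_k) : Prop :=
  A^T *m A = 1%:M.

Definition rect_diag (R : pzRingType) (n m : nat) (s : nat -> R) : 'M[R]_(n, m) :=
  \matrix_(i < n, j < m) (if (i == j :> nat) then s i else 0).

Definition is_svd (R : realType) (n m : nat) (A : 'M[R]_(n, m))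
    (U : 'M[R]_n) (s : nat -> R) (V : 'M[R]_m) : Prop :=
  [/\ orthogonal_mx U,
      orthogonal_mx V,
      forall i, (i < minn n m)%N -> 0 <= s i,
      forall i j, (i <= j)%N -> (j < minn n m)%N -> s j <= s i
    & A = U *m rect_diag n m s *m V^T].

(* The norm that MathComp-Analysis puts on matrices is the max norm, hence the
   explicit Euclidean norm and the operator norm it induces. *)
Definition l2norm (R : realType) (k : nat) (v : 'cV[R]_k) : R :=
  Num.sqrt (\sum_(i < k) v i ord0 ^+ 2).

Definition spectral_norm (R : realType) (n m : nat) (A : 'M[R]_(n, m)) : R :=
  sup [set l2norm (A *m v) | v in [set v : 'cV[R]_m | l2norm v <= 1]].

Section RandomVectors.
Context (R : realType) (d : measure_display) (T : measurableType d).
Context (P : probability T R).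

Definition rvec (k : nat) (X : 'I_k -> {RV P >-> R}) (t : T) : 'cV[R]_k :=
  \col_i X i t.

(* Square-integrable and zero-mean, with the identity as covariance matrix. *)
Definition standardized (k : nat) (X : 'I_k -> {RV P >-> R}) : Prop :=
  [/\ forall i, (X i : T -> R) \in Lfun P 2%:E,
      forall i, ('E_P[X i] = 0)%E
    & forall i j, covariance P (X i) (X j) = ((i == j)%:R)%:E].

Definition uncorrelated (k l : nat) (X : 'I_k -> {RV P >-> R})
    (Y : 'I_l -> {RV P >-> R}) : Prop :=
  forall i j, covariance P (X i) (Y j) = 0%E.

Definition expectation_mx (p q : nat) (A : T -> 'M[R]_(p, q)) : 'M[R]_(p, q) :=
  \matrix_(i, j) fine ('E_P[fun t => A t i j])%E.

Definition observation (n m : nat) (H : 'M[R]_(n, m)) (eps : R)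
    (X : 'I_m -> {RV P >-> R}) (N : 'I_n -> {RV P >-> R}) (t : T) : 'cV[R]_n :=
  H *m rvec X t + Num.sqrt eps *: rvec N t.

Definition mse (n m : nat) (H : 'M[R]_(n, m)) (eps : R)
    (X : 'I_m -> {RV P >-> R}) (N : 'I_n -> {RV P >-> R})
    (W : 'M[R]_(m, n)) : R :=
  let err t := W *m observation H eps X N t - rvec X t in
  \tr (expectation_mx (fun t => err t *m (err t)^T)).

End RandomVectors.

Section Estimators.
Context (R : realType) (n m : nat).
Context (eps : R) (U : 'M[R]_n) (sigma : nat -> R) (V : 'M[R]_m).

Let Sigma : 'M[R]_(n, m) := rect_diag n m sigma.

Definition W_MMSE : 'M[R]_(m, n) :=
  V *m Sigma^T *m invmx (Sigma *m Sigma^T + eps%:M) *m U^T.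

Definition W_rMMSE (r : nat) : 'M[R]_(m, n) :=
  V *m pid_mx r *m Sigma^T *m invmx (Sigma *m Sigma^T + eps%:M) *m U^T.

Definition W_rSVD (r : nat) : 'M[R]_(m, n) :=
  V *m rect_diag m n (fun i => if (i < r)%N then (sigma i)^-1 else 0) *m U^T.

End Estimators.

(* A condition on two families of singular values, gamma and sigma, in which
   sigma occurs only through the norm d of the perturbation. *)
Definition pairwise_separated (R : realType) (r : nat) (d : R)
    (gamma : nat -> R) : Prop :=
  gamma r.-1 > d /\
  trivIset [set i | (i < r)%N]
    (fun i => `[gamma i - d, gamma i + Num.sqrt 2 * d]%classic).

(* The relation between the two models y = H x + sqrt(eps) n and
   y = (H + dH) x' + sqrt(eps) n' constrains only eps, the spectral norm d of dH
   and the singular values gamma of H and sigma of H + dH; none of its clauses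
   mentions the random vectors. *)
Definition corresponding_pair (R : realType) (m r : nat) (kappa eps d : R)
    (gamma sigma : nat -> R) : Prop :=
  [/\ 1 < kappa,
      (1 <= r < m)%N,
      pairwise_separated r d gamma,
      forall i, (i < r)%N ->
        kappa * Num.sqrt eps < gamma i /\ kappa * Num.sqrt eps < sigma i
    & forall i, (r <= i < m)%N ->
        gamma i <= Num.sqrt eps /\ sigma i <= Num.sqrt eps].

Section Bounds.
Context (R : realType).
Implicit Types (gamma sigma : nat -> R) (eps d : R) (m r i : nat).

Definition sv_gap gamma sigma i : R :=
  if i == 0%N then `|sigma 0%N - gamma 1%N|
  else Num.min `|sigma i - gamma i.-1| `|sigma i - gamma i.+1|.

Definition rho d gamma sigma i : R := 1 - d ^+ 2 / sv_gap gamma sigma i ^+ 2.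

Definition J0_rMMSE m r eps gamma sigma : R :=
  let x i := sigma i / (sigma i ^+ 2 + eps) in
  \sum_(i < r) x i ^+ 2 * (gamma i ^+ 2 + eps)
  - 2 * (\sum_(i < r) x i * gamma i) + m%:R.

Definition J0_rSVD m r eps gamma sigma : R :=
  \sum_(i < r) (gamma i ^+ 2 + eps) / sigma i ^+ 2
  - 2 * (\sum_(i < r) gamma i / sigma i) + m%:R.

End Bounds.

(* Main.v *)
(* With K = U^T M and L = N^T V, an estimator V D U^T with D = diag(s_i) has mean
   square error sum_ij (s_i gamma_j k_ij - l_ji)^2 + eps sum_i s_i^2. When s_i = 0
   for i >= r, the corresponding rows contribute m - r, which settles the
   comparison with W_MMSE and reduces the two bounds to the rows i < r.
   For such a row, multiplying the two relations between singular vectors by M^T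
   and N^T gives sigma_i k_ij - gamma_j l_ji = p_j and
   sigma_i l_ji - gamma_j k_ij = q_j, where p and q have norm at most ||dH||. Hence
   k_ij^2 + l_ji^2 <= (p_j^2 + q_j^2) / (sigma_i - gamma_j)^2, and Weyl's
   inequality with the separation hypothesis gives |sigma_i - gamma_j| >= delta_i
   for j <> i. Summing, (1 - k_ii^2) + (1 - l_ii^2) <= 2 (1 - rho_i) < 1. Finally
   k_ii and l_ii have the same sign, because
   (k_ii - l_ii) (sigma_i + gamma_i) = p_i - q_i while sigma_i + gamma_i > 2 ||dH||. *)

Require Import Defs.
From HB Require Import structures.
From mathcomp Require Import all_boot all_order all_algebra.
From mathcomp Require Import ring lra.
From mathcomp Require Import all_classical all_reals all_analysis.

Set Implicit Arguments.
Unset Strict Implicit.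
Unset Printing Implicit Defensive.

Import Order.TTheory GRing.Theory Num.Theory.

Local Open Scope classical_set_scope.
Local Open Scope ring_scope.

(** * Euclidean norm, orthogonal matrices and the spectral norm *)

Section EuclideanNorm.
Context (R : realType).

Definition sqnorm (k : nat) (v : 'cV[R]_k) : R := \sum_(i < k) v i ord0 ^+ 2.

Lemma sqnorm_ge0 k (v : 'cV[R]_k) : 0 <= sqnorm v.
Proof. by apply: sumr_ge0 => i _; exact: sqr_ge0. Qed.

Lemma sqnorm_eq0 k (v : 'cV[R]_k) : sqnorm v = 0 -> v = 0.
Proof.
move=> v0; apply/matrixP => i j; rewrite ord1 mxE.
apply/eqP; rewrite -sqrf_eq0; apply/eqP.
by apply: (psumr_eq0P _ v0) => // ? _; exact: sqr_ge0.
Qed.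

Lemma sqnormE k (v : 'cV[R]_k) : v^T *m v = (sqnorm v)%:M.
Proof.
apply/matrixP => i j; rewrite !ord1 !mxE eqxx mulr1n.
by apply: eq_bigr => l _; rewrite mxE -expr2.
Qed.

Lemma l2normE k (v : 'cV[R]_k) : l2norm v = Num.sqrt (sqnorm v).
Proof. by []. Qed.

Lemma l2norm_sqr k (v : 'cV[R]_k) : l2norm v ^+ 2 = sqnorm v.
Proof. by rewrite sqr_sqrtr// sqnorm_ge0. Qed.

Lemma l2norm_ge0 k (v : 'cV[R]_k) : 0 <= l2norm v.
Proof. exact: sqrtr_ge0. Qed.

Lemma l2norm_gt0 k (v : 'cV[R]_k) : v != 0 -> 0 < l2norm v.
Proof.
move=> v0; rewrite sqrtr_gt0 lt_neqAle sqnorm_ge0 andbT eq_sym.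
by apply: contra v0 => /eqP/sqnorm_eq0 ->.
Qed.

Lemma l2norm0 k : l2norm (0 : 'cV[R]_k) = 0.
Proof.
by rewrite /l2norm big1 ?sqrtr0// => i _; rewrite mxE expr0n.
Qed.

Lemma l2normZ k (a : R) (v : 'cV[R]_k) : l2norm (a *: v) = `|a| * l2norm v.
Proof.
rewrite /l2norm -sqrtr_sqr -sqrtrM ?sqr_ge0// mulr_sumr.
by under eq_bigr do rewrite mxE exprMn.
Qed.

Lemma l2normN k (v : 'cV[R]_k) : l2norm (- v) = l2norm v.
Proof. by rewrite -scaleN1r l2normZ normrN1 mul1r. Qed.

Definition dotcv k (u v : 'cV[R]_k) : R := \sum_i u i ord0 * v i ord0.

Lemma dotcvE k (u v : 'cV[R]_k) : u^T *m v = (dotcv u v)%:M.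
Proof.
apply/matrixP => i j; rewrite !ord1 !mxE eqxx mulr1n.
by apply: eq_bigr => l _; rewrite mxE.
Qed.

Lemma dotcv_trmx m n (A : 'M[R]_(m, n)) u v :
  dotcv u (A *m v) = dotcv (A^T *m u) v.
Proof.
have := dotcvE u (A *m v); rewrite mulmxA -{1}[A]trmxK -trmx_mul dotcvE.
by move/matrixP/(_ ord0 ord0); rewrite !mxE.
Qed.

Lemma sqnormD k (u v : 'cV[R]_k) :
  sqnorm (u + v) = sqnorm u + 2 * dotcv u v + sqnorm v.
Proof.
rewrite /sqnorm /dotcv mulr_sumr -!big_split/=.
by apply: eq_bigr => i _; rewrite mxE; ring.
Qed.

Lemma dotcv_le k (u v : 'cV[R]_k) : dotcv u v <= l2norm u * l2norm v.
Proof.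
have [->|/l2norm_gt0 v0] := eqVneq v 0.
  rewrite l2norm0 mulr0 /dotcv big1// => i _; by rewrite mxE mulr0.
have [->|/l2norm_gt0 u0] := eqVneq u 0.
  rewrite l2norm0 mul0r /dotcv big1// => i _; by rewrite mxE mul0r.
(* Cauchy-Schwarz: with a = |u| |v|, this squared norm expands to 2 a (a - u.v). *)
have := sqnorm_ge0 (l2norm v *: u + (- l2norm u) *: v).
rewrite sqnormD -!l2norm_sqr !l2normZ.
have -> : dotcv (l2norm v *: u) (- l2norm u *: v) =
    - (l2norm u * l2norm v) * dotcv u v.
  by rewrite /dotcv mulr_sumr; apply: eq_bigr => i _; rewrite !mxE; ring.
rewrite normrN !gtr0_norm// => h.
have uv0 : 0 < l2norm u * l2norm v by rewrite mulr_gt0.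
rewrite -(ler_pM2l uv0); nra.
Qed.

Lemma ler_l2normD k (u v : 'cV[R]_k) : l2norm (u + v) <= l2norm u + l2norm v.
Proof.
rewrite -(ler_pXn2r (ltn0Sn 1)) ?nnegrE ?addr_ge0 ?l2norm_ge0//.
rewrite l2norm_sqr sqnormD -!l2norm_sqr; have := dotcv_le u v; nra.
Qed.

Lemma orthogonal_mxC k (A : 'M[R]_k) : orthogonal_mx A -> A *m A^T = 1%:M.
Proof. exact: mulmx1C. Qed.

Lemma orthogonal_trmx k (A : 'M[R]_k) : orthogonal_mx A -> orthogonal_mx A^T.
Proof. by move/orthogonal_mxC; rewrite /orthogonal_mx trmxK. Qed.

Lemma orthogonal_mulmx k (A B : 'M[R]_k) :
  orthogonal_mx A -> orthogonal_mx B -> orthogonal_mx (A *m B).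
Proof.
by move=> oA oB; rewrite /orthogonal_mx trmx_mul mulmxA -(mulmxA B^T) oA mulmx1.
Qed.

Lemma sqnorm_orthogonal k (A : 'M[R]_k) v :
  orthogonal_mx A -> sqnorm (A *m v) = sqnorm v.
Proof.
move=> oA; have := sqnormE (A *m v).
rewrite trmx_mul mulmxA -(mulmxA _ A^T) oA mulmx1 sqnormE.
by move/matrixP/(_ ord0 ord0); rewrite !mxE.
Qed.

Lemma l2norm_orthogonal k (A : 'M[R]_k) v :
  orthogonal_mx A -> l2norm (A *m v) = l2norm v.
Proof. by move=> oA; rewrite !l2normE sqnorm_orthogonal. Qed.

Lemma orthogonal_row_sqr k (A : 'M[R]_k) i :
  orthogonal_mx A -> \sum_j A i j ^+ 2 = 1.
Proof.
move=> /orthogonal_mxC/matrixP/(_ i i); rewrite !mxE eqxx mulr1n => <-.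
by apply: eq_bigr => j _; rewrite mxE expr2.
Qed.

Lemma orthogonal_col_sqr k (A : 'M[R]_k) j :
  orthogonal_mx A -> \sum_i A i j ^+ 2 = 1.
Proof.
move=> /orthogonal_trmx/(orthogonal_row_sqr j) <-.
by apply: eq_bigr => i _; rewrite mxE.
Qed.

(** Needed because [sup] is an upper bound only of a set that is bounded. Entries of a vector in the
    unit ball are at most 1 in absolute value, so each entry of [A *m v] is bounded by the l1 norm
    of a row. *)
Lemma spectral_norm_has_sup m n (A : 'M[R]_(m, n)) :
  has_sup [set l2norm (A *m v) | v in [set v : 'cV[R]_n | l2norm v <= 1]].
Proof.
split; first by exists (l2norm (A *m 0)), 0; rewrite //= l2norm0.
exists (Num.sqrt (\sum_i (\sum_j `|A i j|) ^+ 2)) => _ [v /= v1 <-].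
apply: ler_wsqrtr; apply: ler_sum => i _; rewrite mxE -real_normK ?num_real//.
rewrite ler_pXn2r ?nnegrE ?sumr_ge0//.
apply: (le_trans (ler_norm_sum _ _ _)); apply: ler_sum => j _.
rewrite normrM ler_piMr//; apply: le_trans v1.
rewrite -sqrtr_sqr; apply: ler_wsqrtr.
by rewrite (bigD1 j)//= lerDl sumr_ge0// => l _; exact: sqr_ge0.
Qed.

Lemma l2norm_mulmx_le_spectral_norm m n (A : 'M[R]_(m, n)) v :
  l2norm v <= 1 -> l2norm (A *m v) <= spectral_norm A.
Proof.
by move=> v1; apply: sup_upper_bound; [exact: spectral_norm_has_sup|exists v].
Qed.

Lemma spectral_norm_ge0 m n (A : 'M[R]_(m, n)) : 0 <= spectral_norm A.
Proof.
have := @l2norm_mulmx_le_spectral_norm _ _ A 0.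
by rewrite mulmx0 !l2norm0; apply.
Qed.

Lemma l2norm_mulmx_le m n (A : 'M[R]_(m, n)) v :
  l2norm (A *m v) <= spectral_norm A * l2norm v.
Proof.
have [->|/l2norm_gt0 v0] := eqVneq v 0.
  by rewrite mulmx0 !l2norm0 mulr0.
rewrite -ler_pdivrMr//.
have -> : l2norm (A *m v) / l2norm v = l2norm (A *m ((l2norm v)^-1 *: v)).
  by rewrite -scalemxAr l2normZ gtr0_norm ?invr_gt0// mulrC.
apply: l2norm_mulmx_le_spectral_norm.
by rewrite l2normZ gtr0_norm ?invr_gt0// mulVf ?gt_eqF.
Qed.

(** By adjunction |A^T u|^2 = u.(A A^T u) <= |u| ||A|| |A^T u|; then divide by |A^T u|. *)
Lemma l2norm_trmulmx_le m n (A : 'M[R]_(m, n)) u :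
  l2norm (A^T *m u) <= spectral_norm A * l2norm u.
Proof.
have [->|/l2norm_gt0 v0] := eqVneq (A^T *m u) 0.
  by rewrite l2norm0 mulr_ge0 ?spectral_norm_ge0 ?l2norm_ge0.
rewrite -(ler_pM2r v0) -expr2 l2norm_sqr.
have -> : sqnorm (A^T *m u) = dotcv u (A *m (A^T *m u)).
  by rewrite dotcv_trmx; apply: eq_bigr => i _; rewrite expr2.
apply: (le_trans (dotcv_le _ _)).
rewrite (mulrC (spectral_norm A)) -mulrA ler_wpM2l ?l2norm_ge0//.
exact: l2norm_mulmx_le.
Qed.

End EuclideanNorm.

(** * Products with rectangular diagonal matrices *)

Section RectDiag.
Context (R : realType) (n m : nat) (hmn : (m <= n)%N).
Implicit Types s : nat -> R.

Local Notation w := (widen_ord hmn).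

Lemma trmx_rect_diag p q s : (rect_diag p q s)^T = rect_diag q p s.
Proof.
by apply/matrixP => i j; rewrite !mxE eq_sym; case: eqP => // ->.
Qed.

Lemma mul_rect_diag_tall p s (A : 'M[R]_(m, p)) i j :
  (rect_diag n m s *m A) (w i) j = s i * A i j.
Proof.
rewrite mxE (bigD1 i)//= big1 ?addr0 => [|k ki]; rewrite !mxE /= ?eqxx//.
by rewrite eq_sym ifN ?mul0r.
Qed.

Lemma mul_rect_diag_tall0 p s (A : 'M[R]_(m, p)) (k : 'I_n) j :
  (m <= k)%N -> (rect_diag n m s *m A) k j = 0.
Proof.
move=> mk; rewrite mxE big1// => l _; rewrite !mxE ifN ?mul0r//.
by rewrite neq_ltn (leq_trans (ltn_ord l) mk) orbT.
Qed.

Lemma mul_rect_diag_wide p s (A : 'M[R]_(n, p)) i j :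
  (rect_diag m n s *m A) i j = s i * A (w i) j.
Proof.
rewrite mxE (bigD1 (w i))//= big1 ?addr0 => [|k ki]; rewrite !mxE /= ?eqxx//.
by rewrite ifN ?mul0r//; apply: contra ki => /eqP ik; exact/eqP/val_inj.
Qed.

Lemma mulmx_rect_diag_tall p s (A : 'M[R]_(p, n)) i j :
  (A *m rect_diag n m s) i j = A i (w j) * s j.
Proof.
by rewrite -[A *m _]trmxK mxE trmx_mul trmx_rect_diag mul_rect_diag_wide mxE mulrC.
Qed.

Lemma mulmx_rect_diag_wide p s (A : 'M[R]_(p, m)) i j :
  (A *m rect_diag m n s) i (w j) = A i j * s j.
Proof.
by rewrite -[A *m _]trmxK mxE trmx_mul trmx_rect_diag mul_rect_diag_tall mxE mulrC.
Qed.

Lemma mul_rect_diag s t :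
  rect_diag m n s *m rect_diag n m t = rect_diag m m (fun i => s i * t i).
Proof.
apply/matrixP => i j; rewrite mul_rect_diag_wide !mxE /=.
by case: eqP; rewrite ?mulr0.
Qed.

Lemma big_widen (F : 'I_n -> R) :
  \sum_i F i = \sum_(i < m) F (w i) + \sum_(i < n | (m <= i)%N) F i.
Proof.
rewrite (bigID (fun i : 'I_n => (i < m)%N))/= big_ord_narrow; congr (_ + _).
by apply: eq_bigl => i; rewrite -leqNgt.
Qed.

Lemma sqnorm_rect_diag s (c : 'cV[R]_m) :
  sqnorm (rect_diag n m s *m c) = \sum_(i < m) s i ^+ 2 * c i ord0 ^+ 2.
Proof.
rewrite /sqnorm big_widen [X in _ + X]big1 ?addr0 => [|k mk]; last first.
  by rewrite mul_rect_diag_tall0// expr0n.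
by apply: eq_bigr => i _; rewrite mul_rect_diag_tall exprMn.
Qed.

End RectDiag.

(** * Weyl's inequality for singular values *)

Section Weyl.
Context (R : realType) (n m : nat) (hmn : (m <= n)%N).

Lemma sqnorm_svd (A : 'M[R]_(n, m)) U s V v : is_svd A U s V ->
  sqnorm (A *m v) = \sum_(i < m) s i ^+ 2 * (V^T *m v) i ord0 ^+ 2.
Proof.
case=> oU _ _ _ ->; rewrite -!mulmxA sqnorm_orthogonal//.
by rewrite sqnorm_rect_diag.
Qed.

(* Courant-Fischer by dimension count: some nonzero vector lies both in the span
   of the first i+1 right singular vectors of A and in the orthogonal complement
   of the first i right singular vectors of B. *)
Lemma exists_mixed_vector (V N : 'M[R]_m) (i : 'I_m) :
  exists2 c : 'cV[R]_m, c != 0 &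
    (forall j : 'I_m, (i < j)%N -> c j ord0 = 0) /\
    (forall j : 'I_m, (j < i)%N -> (N^T *m (V *m c)) j ord0 = 0).
Proof.
(* Rows below i encode orthogonality to the columns of [N], rows above i kill the coordinates of c,
   and row i is zero, so [Q] is singular; its kernel supplies c. *)
pose Q : 'M[R]_m := \matrix_(j, k)
  if (j < i)%N then (N^T *m V) j k else if j == i then 0 else (j == k)%:R.
have [|c c0 cQ] := @det0P R m Q^T _.
  rewrite det_tr (expand_det_row _ i) big1// => k _.
  by rewrite !mxE ltnn eqxx mul0r.
have {}cQ : Q *m c^T = 0 by rewrite -[Q]trmxK -trmx_mul cQ trmx0.
exists c^T; first by rewrite trmx_eq0.
have {}cQ j : \sum_k Q j k * c^T k ord0 = 0.
  by have := congr1 (fun A : 'cV[R]_m => A j ord0) cQ; rewrite !mxE.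
split=> j ji; rewrite -(cQ j).
  rewrite (bigD1 j)//= big1 => [|k kj].
    by rewrite addr0 !mxE ltnNge ltnW//= gt_eqF// eqxx mul1r.
  by rewrite mxE ltnNge ltnW//= gt_eqF// eq_sym (negPf kj) mul0r.
by rewrite mulmxA mxE; apply: eq_bigr => k _; rewrite [Q j k]mxE ji.
Qed.

(** On the mixed vector, A stretches by at least [s i] (only indices up to i occur) and B by at most
    [g i] (only indices from i on occur), while A - B adds at most d. *)
Lemma weyl_singular_value (A B : 'M[R]_(n, m)) U s V M g N (d : R) (i : 'I_m) :
  is_svd A U s V -> is_svd B M g N ->
  (forall v, l2norm ((A - B) *m v) <= d * l2norm v) -> s i <= g i + d.
Proof.
move=> svdA svdB hd; have [c c0 [cgt clt]] := exists_mixed_vector V N i.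
have minE : minn n m = m by exact/minn_idPr.
have [_ oV s0 sdec _] := svdA; have [_ _ g0 gdec _] := svdB.
rewrite minE in s0 sdec g0 gdec.
have cp := l2norm_gt0 c0.
have Vc : l2norm (V *m c) = l2norm c by rewrite l2norm_orthogonal.
have lA : s i * l2norm c <= l2norm (A *m (V *m c)).
  rewrite -(ler_pXn2r (ltn0Sn 1)) ?nnegrE ?mulr_ge0 ?l2norm_ge0 ?s0//.
  rewrite exprMn !l2norm_sqr (sqnorm_svd _ svdA) mulmxA oV mul1mx mulr_sumr.
  apply: ler_sum => j _; have [ij|ji] := ltnP i j.
    by rewrite cgt// expr0n !mulr0.
  by rewrite ler_wpM2r ?sqr_ge0// ler_pXn2r ?nnegrE ?s0 ?sdec.
have lB : l2norm (B *m (V *m c)) <= g i * l2norm c.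
  rewrite -Vc -(ler_pXn2r (ltn0Sn 1)) ?nnegrE ?mulr_ge0 ?l2norm_ge0 ?g0//.
  have [_ oN _ _ _] := svdB.
  rewrite exprMn !l2norm_sqr (sqnorm_svd _ svdB).
  rewrite -(sqnorm_orthogonal (V *m c) (orthogonal_trmx oN)) mulr_sumr.
  apply: ler_sum => j _; have [ij|ji] := ltnP j i.
    by rewrite clt// expr0n !mulr0.
  by rewrite ler_wpM2r ?sqr_ge0// ler_pXn2r ?nnegrE ?g0 ?gdec.
rewrite -(ler_pM2r cp); apply: (le_trans lA).
have -> : A *m (V *m c) = B *m (V *m c) + (A - B) *m (V *m c).
  by rewrite mulmxBl addrC subrK.
apply: (le_trans (ler_l2normD _ _)); rewrite mulrDl lerD//.
by rewrite -Vc.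
Qed.

End Weyl.

(** * Perturbation of singular vectors, in the style of Wedin *)

Lemma col_sqr_le (R : realType) (p q : nat) (A : 'M[R]_(p, q)) (O : 'M[R]_p)
    (O' : 'M[R]_q) (d : R) i :
  orthogonal_mx O -> orthogonal_mx O' -> 0 <= d ->
  (forall v, l2norm (A *m v) <= d * l2norm v) ->
  \sum_k (O *m A *m O') k i ^+ 2 <= d ^+ 2.
Proof.
move=> oO oO' d0 hd.
have -> : \sum_k (O *m A *m O') k i ^+ 2 =
    l2norm (O *m (A *m (O' *m delta_mx i ord0))) ^+ 2.
  by rewrite l2norm_sqr !mulmxA -colE; apply: eq_bigr => k _; rewrite [in RHS]mxE.
rewrite l2norm_orthogonal// ler_pXn2r ?nnegrE ?l2norm_ge0//.
apply: (le_trans (hd _)); rewrite ler_piMr// l2norm_orthogonal//.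
rewrite /l2norm (bigD1 i)//= big1 => [|k ki]; rewrite mxE ?(negPf ki) ?expr0n//.
by rewrite !eqxx/= expr1n addr0 sqrtr1.
Qed.

Section Wedin.
Context (R : realType) (n m : nat) (hmn : (m <= n)%N).
Context (H E : 'M[R]_(n, m)) (M U : 'M[R]_n) (N V : 'M[R]_m).
Context (gamma sigma : nat -> R).
Hypothesis svdH : is_svd H M gamma N.
Hypothesis svdHE : is_svd (H + E) U sigma V.

Local Notation w := (widen_ord hmn).
Let K := U^T *m M.
Let L := N^T *m V.
Let d := spectral_norm E.

Lemma orthogonal_K : orthogonal_mx K.
Proof.
case: svdH => oM _ _ _ _; case: svdHE => oU _ _ _ _.
exact: orthogonal_mulmx (orthogonal_trmx oU) oM.
Qed.

Lemma orthogonal_L : orthogonal_mx L.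
Proof.
case: svdH => _ oN _ _ _; case: svdHE => _ oV _ _ _.
exact: orthogonal_mulmx (orthogonal_trmx oN) oV.
Qed.

Lemma perturbation_right :
  M^T *m E *m V = K^T *m rect_diag n m sigma - rect_diag n m gamma *m L.
Proof.
case: svdH => oM oN _ _ eH; case: svdHE => oU oV _ _ eHE.
have -> : E = (H + E) - H by rewrite addrC addKr.
rewrite eHE eH mulmxBr mulmxBl /K /L trmx_mul trmxK !mulmxA oM mul1mx.
by rewrite -!(mulmxA _ V^T V) oV mulmx1.
Qed.

Lemma perturbation_left :
  N^T *m E^T *m U = L *m rect_diag m n sigma - rect_diag m n gamma *m K^T.
Proof.
case: svdH => oM oN _ _ eH; case: svdHE => oU oV _ _ eHE.
have -> : E = (H + E) - H by rewrite addrC addKr.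
rewrite eHE eH linearB/= !trmx_mul !trmxK !trmx_rect_diag.
rewrite mulmxBr mulmxBl /L !mulmxA oN mul1mx.
by rewrite -!(mulmxA _ U^T U) oU mulmx1.
Qed.

(** Column i of [P] and of [Q] are the vectors p and q of the overview; those of [P] have n
    entries. *)
Let P := M^T *m E *m V.
Let Q := N^T *m E^T *m U.

Lemma perturbation_right_widen (i j : 'I_m) :
  P (w j) i = K (w i) (w j) * sigma i - gamma j * L j i.
Proof.
rewrite /P perturbation_right mxE (mulmx_rect_diag_tall hmn).
by rewrite [_^T _ _]mxE [X in _ + X]mxE (mul_rect_diag_tall hmn).
Qed.

(** Rows of Gamma from m on vanish. These entries control the part of a row of K beyond its first m
    columns. *)
Lemma perturbation_right_tail (i : 'I_m) (k : 'I_n) :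
  (m <= k)%N -> P k i = K (w i) k * sigma i.
Proof.
move=> mk; rewrite /P perturbation_right mxE (mulmx_rect_diag_tall hmn).
by rewrite [_^T _ _]mxE [X in _ + X]mxE mul_rect_diag_tall0// subr0.
Qed.

Lemma perturbation_left_widen (i j : 'I_m) :
  Q j (w i) = L j i * sigma i - gamma j * K (w i) (w j).
Proof.
rewrite /Q perturbation_left mxE (mulmx_rect_diag_wide hmn) [X in _ + X]mxE.
by rewrite (mul_rect_diag_wide hmn) [_^T _ _]mxE.
Qed.

Lemma perturbation_right_col_le i : \sum_k P k i ^+ 2 <= d ^+ 2.
Proof.
have [oM _ _ _ _] := svdH; have [_ oV _ _ _] := svdHE.
apply: col_sqr_le => //; [exact: orthogonal_trmx|exact: spectral_norm_ge0|].
exact: l2norm_mulmx_le.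
Qed.

Lemma perturbation_left_col_le i : \sum_k Q k i ^+ 2 <= d ^+ 2.
Proof.
have [_ oN _ _ _] := svdH; have [oU _ _ _ _] := svdHE.
apply: col_sqr_le => //; [exact: orthogonal_trmx|exact: spectral_norm_ge0|].
exact: l2norm_trmulmx_le.
Qed.

Hypothesis gamma_ge0 : forall j : 'I_m, 0 <= gamma j.
Hypothesis sigma_ge0 : forall j : 'I_m, 0 <= sigma j.

(** Both defects are sums of off-diagonal squares, since row i of K and column i of L are unit
    vectors. Columns of K beyond m act as if paired with a zero singular value, whence the condition
    [delta <= sigma i]. *)
Lemma wedin_sin_theta (i : 'I_m) (delta : R) : 0 < delta -> delta <= sigma i ->
  (forall j : 'I_m, j != i -> delta <= `|sigma i - gamma j|) ->
  (1 - K (w i) (w i) ^+ 2) + (1 - L i i ^+ 2) <= 2 * (d ^+ 2 / delta ^+ 2).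
Proof.
move=> delta0 dsi dsg.
rewrite mulrA ler_pdivlMr ?exprn_gt0//.
apply: (@le_trans _ _ (\sum_k P k i ^+ 2 + \sum_k Q k (w i) ^+ 2)); last first.
  by rewrite mulr_natl mulr2n lerD ?perturbation_right_col_le ?perturbation_left_col_le.
rewrite -[in X in X - K _ _ ^+ 2](orthogonal_row_sqr (w i) orthogonal_K).
rewrite -(orthogonal_col_sqr i orthogonal_L).
rewrite !(big_widen hmn) (bigD1 i)//= [X in _ + (X - L i i ^+ 2)](bigD1 i)//=.
rewrite [X in _ <= X + _ + _](bigD1 i)//= [X in _ <= _ + X](bigD1 i)//=.
(* [s1], [s2], [s3]: off-diagonal part of the row of K, its tail beyond m, off-diagonal part of the
   column of L. [s4], [s5], [s6]: the matching parts of [P], [P] and [Q]. *)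
set s1 := \sum_(_ < _ | _) _; set s2 := \sum_(_ < _ | _) _.
set s3 := \sum_(_ < _ | _) _; set s4 := \sum_(_ < _ | _) _.
set s5 := \sum_(_ < _ | _) _; set s6 := \sum_(_ < _ | _) _.
have tail : s2 * delta ^+ 2 <= s5.
  rewrite mulr_suml; apply: ler_sum => k mk.
  rewrite perturbation_right_tail// exprMn ler_wpM2l ?sqr_ge0//.
  by rewrite ler_pXn2r ?nnegrE ?(ltW delta0).
have body : (s1 + s3) * delta ^+ 2 <= s4 + s6.
  rewrite -!big_split/= mulr_suml; apply: ler_sum => j ji.
  rewrite perturbation_right_widen perturbation_left_widen.
  have : delta ^+ 2 <= (sigma i - gamma j) ^+ 2.
    by rewrite -[leRHS]real_normK ?num_real// ler_pXn2r ?nnegrE ?(ltW delta0) ?dsg.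
  have : 0 <= sigma i * gamma j by rewrite mulr_ge0.
  set a := K _ _; set b := L _ _; move: (sigma i) (gamma j) => s g sg h.
  (* The slack of the second inequality is exactly 2 s g (a - b)^2. *)
  apply: (@le_trans _ _ ((a ^+ 2 + b ^+ 2) * (s - g) ^+ 2)).
    by rewrite ler_wpM2l// addr_ge0 ?sqr_ge0.
  have := mulr_ge0 sg (sqr_ge0 (a - b)); nra.
have := sqr_ge0 (P (w i) i); have := sqr_ge0 (Q i (w i)); lra.
Qed.

Lemma same_orientation (i : 'I_m) : 2 * d < sigma i + gamma i ->
  (1 - K (w i) (w i) ^+ 2) + (1 - L i i ^+ 2) < 1 ->
  0 <= K (w i) (w i) * L i i.
Proof.
move=> dsg kl1; rewrite leNgt; apply/negP => kl0.
have hp : P (w i) i ^+ 2 <= d ^+ 2.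
  apply: le_trans (perturbation_right_col_le i).
  by rewrite (bigD1 (w i))//= lerDl sumr_ge0// => k _; exact: sqr_ge0.
have hq : Q i (w i) ^+ 2 <= d ^+ 2.
  apply: le_trans (perturbation_left_col_le (w i)).
  by rewrite (bigD1 i)//= lerDl sumr_ge0// => k _; exact: sqr_ge0.
have d0 : 0 <= d := spectral_norm_ge0 E.
rewrite perturbation_right_widen in hp; rewrite perturbation_left_widen in hq.
move: (gamma_ge0 i) (sigma_ge0 i) hp hq dsg kl0 kl1.
move: (K _ _) (L _ _) (sigma i) (gamma i) d d0 => a b s g e e0 g0 s0 hp hq es ab ab1.
have h1 : 4 * e ^+ 2 < (s + g) ^+ 2.
  have -> : 4 * e ^+ 2 = (2 * e) ^+ 2 by ring.
  by rewrite ltr_pXn2r ?nnegrE ?addr_ge0 ?mulr_ge0.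
(* Opposite signs and a^2 + b^2 > 1 force (a - b)^2 >= 1. *)
have h2 : (s + g) ^+ 2 <= (a - b) ^+ 2 * (s + g) ^+ 2.
  by rewrite ler_peMl ?sqr_ge0//; nra.
(* The left side is (p - q)^2 <= 2 (p^2 + q^2), with p and q each at most e in absolute value. *)
have h3 : (a - b) ^+ 2 * (s + g) ^+ 2 <= 4 * e ^+ 2.
  have -> : (a - b) ^+ 2 * (s + g) ^+ 2 =
    ((a * s - g * b) - (b * s - g * a)) ^+ 2 by ring.
  have := sqr_ge0 ((a * s - g * b) + (b * s - g * a)); nra.
lra.
Qed.

End Wedin.

(** * Error of a single row *)

(** Compares a row with its perfectly aligned version, where k and l are the i-th unit vector up to
    the terms j <> i, which contribute nothing more than their squares. [eta] stands for 1 -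
    rho_i. *)
Lemma row_error_bound (R : realType) m (k l g : 'I_m -> R) (i : 'I_m) (x eta : R) :
  0 <= x -> (forall j, 0 <= g j) -> k i ^+ 2 <= 1 -> l i ^+ 2 <= 1 ->
  (1 - k i ^+ 2) + (1 - l i ^+ 2) <= 2 * eta -> 2 * eta <= 1 ->
  0 <= k i * l i -> (forall j, j != i -> k j ^+ 2 + l j ^+ 2 <= 2 * eta) ->
  `|\sum_j (x * g j * k j - l j) ^+ 2 - (x * g i - 1) ^+ 2|
    <= 2 * \sum_j eta * (x * g j + 1) ^+ 2.
Proof.
move=> x0 g0 k1 l1 kl eta1 kl0 klj.
have a0 j : 0 <= x * g j by rewrite mulr_ge0.
rewrite mulr_sumr (bigD1 i)//= [leRHS](bigD1 i)//=.
set S := \sum_(j < m | _) _; set B := \sum_(j < m | _) _.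
have S0 : 0 <= S by apply: sumr_ge0 => j _; exact: sqr_ge0.
have SB : S <= B.
  apply: ler_sum => j ji; move: (klj j ji) (a0 j).
  move: (x * g j) (k j) (l j) => a b c h ha.
  (* Cauchy-Schwarz: (b^2 + c^2)(a^2 + 1) - (a b - c)^2 = (a c + b)^2, and a^2 + 1 <= (a + 1)^2. *)
  apply: (@le_trans _ _ ((b ^+ 2 + c ^+ 2) * (a + 1) ^+ 2)); last first.
    by rewrite mulrA ler_wpM2r ?sqr_ge0.
  have h1 := mulr_ge0 ha (addr_ge0 (sqr_ge0 b) (sqr_ge0 c)).
  have := sqr_ge0 (a * c + b); nra.
clear klj; have := a0 i; move: (x * g i) (k i) (l i) k1 l1 kl kl0.
move=> a b c b1 c1 bc bc0 ha.
have bc1 : b * c <= 1 by nra.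
(* From (1 - b^2)(1 - c^2) >= 0 one gets (b c)^2 >= b^2 + c^2 - 1 >= 1 - 2 eta >= (1 - 2 eta)^2. *)
have bce : 1 - 2 * eta <= b * c.
  rewrite -(ler_pXn2r (ltn0Sn 1)) ?nnegrE ?subr_ge0//.
  have h1 : 0 <= (1 - b ^+ 2) * (1 - c ^+ 2) by rewrite mulr_ge0 ?subr_ge0.
  have eta0 : 0 <= eta by lra.
  have h2 : 0 <= (1 - 2 * eta) * eta by rewrite mulr_ge0 ?subr_ge0.
  nra.
have a20 := sqr_ge0 a.
(* The first term is at most 4 a eta; the two subtracted ones total at most 2 eta (a^2 + 1). Both
   bounds are below 2 eta (a + 1)^2. *)
have E1 : (a * b - c) ^+ 2 - (a - 1) ^+ 2 =
  2 * (a * (1 - b * c)) - a ^+ 2 * (1 - b ^+ 2) - (1 - c ^+ 2) by ring.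
have hs := mulr_ge0 a20 (_ : 0 <= 1 - b ^+ 2).
have ht := mulr_ge0 a20 (_ : 0 <= 1 - c ^+ 2).
have hu := mulr_ge0 ha (_ : 0 <= 1 - b * c).
have hv := mulr_ge0 ha (_ : 0 <= b * c - (1 - 2 * eta)).
have eta0 : 0 <= eta by lra.
have hw := mulr_ge0 a20 eta0.
have hz := mulr_ge0 ha eta0.
have hkl := mulr_ge0 a20 (_ : 0 <= 2 * eta - ((1 - b ^+ 2) + (1 - c ^+ 2))).
rewrite !subr_ge0 in hs ht hu hv hkl.
move: {hs ht hu hv hkl} (hs b1) (ht c1) (hu bc1) (hv bce) (hkl bc) => hs ht hu hv hkl.
rewrite addrAC E1 ler_norml; apply/andP; split; nra.
Qed.

(** * From random vectors to an algebraic formula for the error *)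

Section SecondMoments.
Context (R : realType) (d : measure_display) (T : measurableType d).
Context (P : probability T R).

Lemma Lfun2_Lfun1 (X : T -> R) : X \in Lfun P 2%:E -> X \in Lfun P 1.
Proof. by apply: Lfun_subset12; rewrite fin_num_measure. Qed.

Lemma expectation_sum_fin (I : finType) (F : I -> T -> R) :
  (forall i, F i \in Lfun P 1) ->
  ('E_P[fun t => (\sum_i F i t)%R] = \sum_i 'E_P[F i])%E.
Proof.
move=> F1; rewrite -(big_map F xpredT (fun X : T -> R => 'E_P[X]%E)) -expectation_sum.
  by congr expectation; apply/funext => t; rewrite big_map fct_sumE.
by move=> X /mapP[i _ ->].
Qed.

(** Pythagoras in L2. The square is written as a product to match the diagonal entries of
    [err t *m (err t)^T]. *)
Lemma second_moment_orthonormal (I : finType) (Y : I -> T -> R) (c : I -> R) :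
  (forall i, Y i \in Lfun P 2%:E) ->
  (forall i j, ('E_P[Y i \* Y j] = ((i == j)%:R)%:E)%E) ->
  ('E_P[fun t => ((\sum_i c i * Y i t) * (\sum_i c i * Y i t))%R]
    = (\sum_i c i ^+ 2)%:E)%E.
Proof.
move=> Y2 YY.
pose F (p : I * I) : T -> R := (c p.1 * c p.2) \o* (Y p.1 \* Y p.2).
have -> : (fun t => ((\sum_i c i * Y i t) * (\sum_i c i * Y i t))%R) =
    (fun t => \sum_p F p t).
  apply/funext => t; rewrite -(pair_big xpredT xpredT (fun i j => F (i, j) t))/=.
  rewrite mulr_suml; apply: eq_bigr => i _; rewrite mulr_sumr.
  by apply: eq_bigr => j _; rewrite /F/=; ring.
rewrite expectation_sum_fin => [|p]; last by rewrite Lfun_scale ?Lfun2_mul_Lfun1.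
rewrite -(pair_big xpredT xpredT (fun i j => 'E_P[F (i, j)]%E))/= -sumEFin.
apply: eq_bigr => i _; rewrite (bigD1 i)//= big1 => [|j ji].
  by rewrite adde0 /F expectationZl/= ?Lfun2_mul_Lfun1// YY eqxx mule1 expr2.
by rewrite /F expectationZl/= ?Lfun2_mul_Lfun1// YY eq_sym (negPf ji) mule0.
Qed.

Lemma expectation_mul_centered (X Y : T -> R) (c : \bar R) :
  X \in Lfun P 2%:E -> Y \in Lfun P 2%:E ->
  ('E_P[X] = 0)%E -> ('E_P[Y] = 0)%E -> covariance P X Y = c ->
  ('E_P[X \* Y] = c)%E.
Proof.
move=> X2 Y2 X0 Y0 <-.
have XY1 : (X * Y)%R \in Lfun P 1 by exact: Lfun2_mul_Lfun1.
by rewrite covarianceE ?(Lfun2_Lfun1 X2) ?(Lfun2_Lfun1 Y2)// X0 mul0e sube0.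
Qed.

Lemma mseE n m (H : 'M[R]_(n, m)) (eps : R) (X : 'I_m -> {RV P >-> R})
    (Z : 'I_n -> {RV P >-> R}) (W : 'M[R]_(m, n)) :
  0 <= eps -> standardized X -> standardized Z -> uncorrelated X Z ->
  mse H eps X Z W = \sum_i \sum_j (W *m H - 1%:M) i j ^+ 2
    + eps * \sum_i \sum_j W i j ^+ 2.
Proof.
move=> eps0 [X2 X0 XX] [Z2 Z0 ZZ] XZ.
rewrite mulr_sumr -big_split /mse /mxtrace/=; apply: eq_bigr => i _; rewrite mxE.
(* Signal and noise together form one orthonormal family indexed by a disjoint sum; coordinate i of
   the error is a linear combination of it with coefficients [c]. *)
pose Y (k : 'I_m + 'I_n) : T -> R :=
  match k with inl j => X j | inr j => Z j end.
pose c (k : 'I_m + 'I_n) : R := match k with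
  inl j => (W *m H - 1%:M) i j | inr j => Num.sqrt eps * W i j end.
transitivity (fine ('E_P[fun t => ((\sum_k c k * Y k t) * (\sum_k c k * Y k t))%R])%E).
  congr (fine (expectation _ _)); apply/funext => t.
  rewrite mxE big_ord1 [_^T _ _]mxE; suff -> :
    (W *m observation H eps X Z t - rvec X t) i ord0 = \sum_k c k * Y k t by [].
  have -> : W *m observation H eps X Z t - rvec X t =
      (W *m H - 1%:M) *m rvec X t + Num.sqrt eps *: (W *m rvec Z t).
    rewrite /observation mulmxDr mulmxBl mul1mx -scalemxAr mulmxA.
    by rewrite -!addrA [_ - rvec X t]addrC.
  rewrite big_sumType/= mxE; congr (_ + _).
    by rewrite mxE; apply: eq_bigr => k _; rewrite [rvec _ _ _ _]mxE.
  rewrite !mxE mulr_sumr; apply: eq_bigr => k _.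
  by rewrite [rvec _ _ _ _]mxE mulrA.
rewrite second_moment_orthonormal => [|[j|j]|[j|j] [k|k]] //=.
- rewrite big_sumType/=; congr (_ + _); rewrite mulr_sumr.
  by apply: eq_bigr => j _; rewrite exprMn sqr_sqrtr.
- exact: expectation_mul_centered.
- exact: expectation_mul_centered.
- by apply: expectation_mul_centered => //; rewrite covarianceC XZ.
- exact: expectation_mul_centered.
Qed.

End SecondMoments.

(** * The mean-square error in singular coordinates *)

Section OrthogonalInvariance.
Context (R : realType).

Definition frobenius (p q : nat) (A : 'M[R]_(p, q)) : R := \sum_i \sum_j A i j ^+ 2.

Lemma frobeniusE p q (A : 'M[R]_(p, q)) : frobenius A = \tr (A *m A^T).
Proof.
apply: eq_bigr => i _; rewrite mxE; apply: eq_bigr => j _.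
by rewrite mxE expr2.
Qed.

Lemma frobenius_mulmxr p q (A : 'M[R]_(p, q)) V :
  orthogonal_mx V -> frobenius (A *m V^T) = frobenius A.
Proof.
move=> oV; rewrite !frobeniusE trmx_mul trmxK mulmxA -(mulmxA A).
by rewrite oV mulmx1.
Qed.

Lemma frobenius_mulmxl p q (A : 'M[R]_(p, q)) U :
  orthogonal_mx U -> frobenius (U *m A) = frobenius A.
Proof.
move=> oU; rewrite !frobeniusE trmx_mul mulmxA mxtrace_mulC !mulmxA oU.
by rewrite mul1mx.
Qed.

End OrthogonalInvariance.

Section MseSvd.
Context (R : realType) (n m : nat) (hmn : (m <= n)%N).
Local Notation w := (widen_ord hmn).

(** With W = V D U^T one has W H - I = V (D K Gamma - L^T) N^T, and the Frobenius norm ignores the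
    outer orthogonal factors. *)
Lemma mse_svd (H : 'M[R]_(n, m)) (M U : 'M[R]_n) (N V : 'M[R]_m)
    (gamma : nat -> R) (eps : R) (d : measure_display) (T : measurableType d)
    (P : probability T R) (X : 'I_m -> {RV P >-> R}) (Z : 'I_n -> {RV P >-> R})
    (s : nat -> R) :
  is_svd H M gamma N -> orthogonal_mx U -> orthogonal_mx V ->
  0 <= eps -> standardized X -> standardized Z -> uncorrelated X Z ->
  mse H eps X Z (V *m rect_diag m n s *m U^T) =
    \sum_(i < m) (\sum_(j < m) (s i * gamma j * (U^T *m M) (w i) (w j)
                                - (N^T *m V) j i) ^+ 2 + eps * s i ^+ 2).
Proof.
move=> svdH oU oV eps0 sX sZ XZ; have [_ oN _ _ eH] := svdH.
rewrite mseE// -!/(frobenius _) big_split/= -mulr_sumr; congr (_ + _ * _).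
  have -> : V *m rect_diag m n s *m U^T *m H - 1%:M =
      V *m ((rect_diag m n s *m (U^T *m M *m rect_diag n m gamma)
             - (N^T *m V)^T) *m N^T).
    rewrite mulmxBl mulmxBr eH trmx_mul trmxK !mulmxA.
    by rewrite (orthogonal_mxC oV) mul1mx (orthogonal_mxC oN).
  rewrite frobenius_mulmxl// frobenius_mulmxr//.
  apply: eq_bigr => i _; apply: eq_bigr => j _.
  rewrite mxE (mul_rect_diag_wide hmn) (mulmx_rect_diag_tall hmn).
  by rewrite [X in _ + X]mxE [_^T _ _]mxE -mulrA (mulrC (gamma j)).
rewrite frobenius_mulmxr// frobenius_mulmxl//.
apply: eq_bigr => i _; rewrite (big_widen hmn) [X in _ + X]big1 ?addr0.
  rewrite (bigD1 i)//= big1 ?addr0 ?mxE/= ?eqxx// => j ji.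
  by rewrite mxE/= eq_sym (negPf (ji : (j : nat) != i)) expr0n.
move=> k mk; rewrite mxE ifN ?expr0n//.
by rewrite neq_ltn (leq_trans (ltn_ord i) mk).
Qed.

Lemma rect_diag_ridge_inv (sigma : nat -> R) (eps : R) : 0 < eps ->
  (rect_diag n m sigma)^T
    *m invmx (rect_diag n m sigma *m (rect_diag n m sigma)^T + eps%:M)
  = rect_diag m n (fun i => sigma i / (sigma i ^+ 2 + eps)).
Proof.
move=> eps0; rewrite trmx_rect_diag; set S := rect_diag n m sigma.
set D := rect_diag m n sigma; set G := S *m D + eps%:M.
have s0 i : sigma i ^+ 2 + eps != 0 by rewrite gt_eqF// ltr_wpDl ?sqr_ge0.
have e : rect_diag m n (fun i => sigma i / (sigma i ^+ 2 + eps)) *m G = D.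
  rewrite mulmxDr mulmxA (mul_rect_diag hmn) mul_mx_scalar.
  apply/matrixP => i j; rewrite mxE [X in _ + X]mxE.
  have -> : rect_diag m m (fun k => sigma k / (sigma k ^+ 2 + eps) * sigma k) *m D =
      rect_diag m n (fun k => sigma k / (sigma k ^+ 2 + eps) * sigma k * sigma k).
    apply/matrixP => k l; rewrite (mul_rect_diag_wide (leqnn m)) !mxE/=.
    by case: eqP; rewrite ?mulr0.
  rewrite !mxE; case: eqP => _; last by rewrite mulr0 addr0.
  by have := s0 i; move=> h; field.
(* [G] is n by n and diagonal, with entries eps from index m on; positivity of eps makes it
   invertible. *)
have GU : G \in unitmx.
  have -> : G = diag_mx (\row_k (if (k < m)%N then sigma k ^+ 2 + eps else eps)).
    apply/matrixP => k l; rewrite !mxE; case: ltnP => km.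
      have {1}-> : k = w (Ordinal km) by exact/val_inj.
      have := mul_rect_diag_tall hmn sigma D (Ordinal km) l.
      rewrite mxE => ->; rewrite mxE/=.
      by rewrite -(val_eqE k l)/=; case: eqP; rewrite ?mulr0 ?addr0 ?expr2.
    by have := mul_rect_diag_tall0 sigma D l km; rewrite mxE => ->; rewrite add0r.
  rewrite unitmxE det_diag unitfE; apply/prodf_neq0 => k _.
  by rewrite mxE; case: ifP => _; [exact: s0|rewrite gt_eqF].
by rewrite -e mulmxK.
Qed.

End MseSvd.

(** * Interlacing of the two families of singular values *)

Section SingularValueGap.
Context (R : realType).

Lemma pairwise_separated_gap r (d : R) (g : nat -> R) i : 0 <= d ->
  pairwise_separated r d g -> (i.+1 < r)%N -> g i.+1 <= g i ->
  g i.+1 + Num.sqrt 2 * d < g i - d.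
Proof.
move=> d0 [_ dis] ir gi; rewrite ltNge; apply/negP => h.
have s20 : 0 <= Num.sqrt 2 * d by rewrite mulr_ge0 ?sqrtr_ge0.
have : i = i.+1; last by move/eqP; rewrite ltn_eqF.
apply: dis => //=; first exact: ltnW.
(* Otherwise the left endpoint of interval i would also lie in interval i+1. *)
by exists (g i - d); split; rewrite /= in_itv/=; apply/andP; split; lra.
Qed.

End SingularValueGap.

Section Alignment.
Context (R : realType) (n m r : nat) (hmn : (m <= n)%N).
Context (H dH : 'M[R]_(n, m)) (M U : 'M[R]_n) (N V : 'M[R]_m).
Context (gamma sigma : nat -> R) (eps kappa : R).
Hypothesis svdH : is_svd H M gamma N.
Hypothesis svdHd : is_svd (H + dH) U sigma V.
Let d := spectral_norm dH.
Hypothesis hpair : corresponding_pair m r kappa eps d gamma sigma.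
Local Notation w := (widen_ord hmn).

Lemma svd_ge0 (A : 'M[R]_(n, m)) U' s V' (i : 'I_m) :
  is_svd A U' s V' -> 0 <= s i.
Proof. by case=> _ _ + _ _; apply; rewrite (minn_idPr hmn). Qed.

Lemma svd_le (A : 'M[R]_(n, m)) U' s V' i j :
  is_svd A U' s V' -> (i <= j)%N -> (j < m)%N -> s j <= s i.
Proof. by case=> _ _ _ + _ ij jm; apply=> //; rewrite (minn_idPr hmn). Qed.

Lemma sigma_le_gamma (i : 'I_m) : sigma i <= gamma i + d.
Proof.
apply: (weyl_singular_value hmn i svdHd svdH) => v.
by rewrite addrC addKr l2norm_mulmx_le.
Qed.

Lemma gamma_le_sigma (i : 'I_m) : gamma i <= sigma i + d.
Proof.
apply: (weyl_singular_value hmn i svdH svdHd) => v.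
by rewrite opprD addNKr mulNmx l2normN l2norm_mulmx_le.
Qed.

(** Inside the first r indices this is separation plus Weyl. At the last one separation is silent,
    and the noise level decides: [gamma r] is at most sqrt eps, below kappa sqrt eps. *)
Lemma gamma_succ_lt_sigma (i : 'I_m) : (i < r)%N -> gamma i.+1 < sigma i.
Proof.
move=> ir; have [kap /andP[_ rm] sep big small] := hpair.
have d0 : 0 <= d := spectral_norm_ge0 dH.
have i1m : (i.+1 < m)%N by exact: leq_trans rm.
have [i1r|ri1] := ltnP i.+1 r.
  have := pairwise_separated_gap d0 sep i1r (svd_le svdH (leqnSn i) i1m).
  have := gamma_le_sigma i; have := mulr_ge0 (sqrtr_ge0 (2 : R)) d0; lra.
have [_ sb] := big i ir; apply: le_lt_trans (_ : kappa * Num.sqrt eps < _) => //.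
have [|gs _] := small i.+1; first by rewrite ri1.
by apply: (le_trans gs); rewrite ler_peMl ?sqrtr_ge0 ?ltW.
Qed.

Lemma sigma_lt_gamma_pred (i : 'I_m) : (0 < i < r)%N -> sigma i < gamma i.-1.
Proof.
case/andP=> i0 ir; have [_ _ sep _ _] := hpair.
have d0 : 0 <= d := spectral_norm_ge0 dH.
have := sigma_le_gamma i; case: i i0 ir => -[//|i] im /= _ ir.
have := pairwise_separated_gap d0 sep ir (svd_le svdH (leqnSn i) im).
have := mulr_ge0 (sqrtr_ge0 (2 : R)) d0; lra.
Qed.

(** Interlacing fixes the signs inside the absolute values. *)
Lemma sv_gapE (i : 'I_m) : (i < r)%N -> sv_gap gamma sigma i =
  if i == 0%N :> nat then sigma i - gamma i.+1
  else Num.min (gamma i.-1 - sigma i) (sigma i - gamma i.+1).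
Proof.
move=> ir; have lo := gamma_succ_lt_sigma ir; rewrite /sv_gap.
case: eqP => [i0|/eqP i0]; first by move: lo; rewrite i0 => lo; rewrite gtr0_norm ?subr_gt0.
have hi : sigma i < gamma i.-1 by apply: sigma_lt_gamma_pred; rewrite lt0n i0.
by rewrite distrC gtr0_norm ?subr_gt0// gtr0_norm ?subr_gt0.
Qed.

Lemma sv_gap_gt0 (i : 'I_m) : (i < r)%N -> 0 < sv_gap gamma sigma i.
Proof.
move=> ir; rewrite sv_gapE//; case: ifPn => i0.
  by rewrite subr_gt0 gamma_succ_lt_sigma.
by rewrite lt_min !subr_gt0 gamma_succ_lt_sigma// sigma_lt_gamma_pred// lt0n i0.
Qed.

Lemma sv_gap_le_succ (i : 'I_m) : (i < r)%N ->
  sv_gap gamma sigma i <= sigma i - gamma i.+1.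
Proof. by move=> ir; rewrite sv_gapE//; case: ifPn => // _; rewrite ge_min lexx orbT. Qed.

Lemma sv_gap_le_sigma (i : 'I_m) : (i < r)%N -> sv_gap gamma sigma i <= sigma i.
Proof.
move=> ir; have [_ /andP[_ rm] _ _ _] := hpair.
(* Since r < m, [gamma i.+1] is a genuine singular value, hence nonnegative. *)
have i1m : (i.+1 < m)%N by exact: leq_trans rm.
apply: le_trans (sv_gap_le_succ ir) _.
by rewrite gerBl (svd_ge0 (Ordinal i1m) svdH).
Qed.

Lemma sv_gap_le (i j : 'I_m) : (i < r)%N -> j != i ->
  sv_gap gamma sigma i <= `|sigma i - gamma j|.
Proof.
move=> ir; rewrite neq_ltn => /orP[ji|ij]; last first.
  apply: le_trans (sv_gap_le_succ ir) (le_trans _ (ler_norm _)).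
  by rewrite lerD2l lerN2 (svd_le svdH).
rewrite sv_gapE// ifN; last by rewrite -lt0n (leq_ltn_trans _ ji).
rewrite ge_min distrC; apply/orP; left; apply: le_trans (ler_norm _).
rewrite lerD2r (svd_le svdH)//; first by rewrite -ltnS (ltn_predK ji).
by rewrite (leq_ltn_trans (leq_pred i)).
Qed.

(** * Alignment of the leading singular vectors *)

Hypothesis hrho : forall i, (i < r)%N -> 1 / 2 < rho d gamma sigma i.
Let K := U^T *m M.
Let L := N^T *m V.

Lemma singular_vectors_close (i : 'I_m) : (i < r)%N ->
  (1 - K (w i) (w i) ^+ 2) + (1 - L i i ^+ 2) <= 2 * (1 - rho d gamma sigma i).
Proof.
move=> ir; rewrite /rho subKr.
apply: (wedin_sin_theta hmn svdH svdHd).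
- by move=> j; exact: svd_ge0 svdH.
- by move=> j; exact: svd_ge0 svdHd.
- exact: sv_gap_gt0.
- exact: sv_gap_le_sigma.
- by move=> j; exact: sv_gap_le.
Qed.

Lemma singular_vectors_same_sign (i : 'I_m) : (i < r)%N ->
  0 <= K (w i) (w i) * L i i.
Proof.
move=> ir; have [_ /andP[_ rm] [gd _] _ _] := hpair.
have d0 : 0 <= d := spectral_norm_ge0 dH.
have hr := hrho ir; have gap0 := sv_gap_gt0 ir.
apply: (same_orientation svdH svdHd).
- by move=> j; exact: svd_ge0 svdH.
- by move=> j; exact: svd_ge0 svdHd.
- have dg : d < gamma i.
    apply: lt_le_trans gd _; apply: (svd_le svdH).
      by rewrite -ltnS (ltn_predK ir).
    exact: leq_ltn_trans (leq_pred r) rm.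
  (* rho_i > 1/2 gives d < delta_i, and delta_i <= sigma_i. *)
  have ds : d < sigma i.
    apply: lt_le_trans (sv_gap_le_sigma ir).
    rewrite -(ltr_pXn2r (ltn0Sn 1)) ?nnegrE ?(ltW gap0)//.
    have : d ^+ 2 / sv_gap gamma sigma i ^+ 2 < 1 by move: hr; rewrite /rho; lra.
    by rewrite ltr_pdivrMr ?exprn_gt0// mul1r.
  rewrite -/d; lra.
- by rewrite -/K -/L; have := singular_vectors_close ir; lra.
Qed.

(** * Mean-square error of truncated estimators *)

Context (dd : measure_display) (T : measurableType dd) (P : probability T R).
Context (X : 'I_m -> {RV P >-> R}) (Z : 'I_n -> {RV P >-> R}).
Hypothesis eps_ge0 : 0 <= eps.
Hypotheses (stdX : standardized X) (stdZ : standardized Z) (uncXZ : uncorrelated X Z).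

Let J := mse H eps X Z.

Let orthoU : orthogonal_mx U. Proof. by case: svdHd. Qed.
Let orthoV : orthogonal_mx V. Proof. by case: svdHd. Qed.

Lemma mse_truncated (rm : (r <= m)%N) (s : nat -> R) :
  J (V *m rect_diag m n (fun i => if (i < r)%N then s i else 0) *m U^T) =
  \sum_(i < r) (\sum_(j < m) (s i * gamma j * K (w (widen_ord rm i)) (w j)
       - L j (widen_ord rm i)) ^+ 2 + eps * s i ^+ 2) + (m%:R - r%:R).
Proof.
rewrite /J (mse_svd hmn _ svdH)// (big_widen rm); congr (_ + _).
  by apply: eq_bigr => i _; rewrite /= ltn_ord.
(* A truncated row reduces to the squared norm of a column of L, which is 1. *)
rewrite (eq_bigr (fun=> 1)) => [|i ri]; last first.
  rewrite ltnNge ri/= expr0n mulr0 addr0.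
  rewrite -[RHS](orthogonal_col_sqr i (orthogonal_L svdH svdHd)).
  by apply: eq_bigr => j _; rewrite !mul0r sub0r sqrrN.
apply: (addrI (\sum_(i < r) (1 : R))).
by rewrite -(big_widen rm) !sumr_const !card_ord addrC subrK.
Qed.

(** Kept general in [s] so that x_i and 1 / sigma_i give the two bounds of the theorem. *)
Lemma mse_truncated_error (s : nat -> R) :
  (forall i, (i < r)%N -> 0 <= s i) ->
  `|J (V *m rect_diag m n (fun i => if (i < r)%N then s i else 0) *m U^T)
    - (\sum_(i < r) ((s i * gamma i - 1) ^+ 2 + eps * s i ^+ 2) + (m%:R - r%:R))|
  <= 2 * (\sum_(i < r) \sum_(j < m)
            (1 - rho d gamma sigma i) * (s i * gamma j + 1) ^+ 2).
Proof.
have [_ /andP[_ /ltnW rm] _ _ _] := hpair.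
move=> s0; rewrite (mse_truncated rm) opprD addrACA subrr addr0 -sumrB mulr_sumr.
apply: (le_trans (ler_norm_sum _ _ _)); apply: ler_sum => i _.
rewrite opprD addrACA subrr addr0.
set i' := widen_ord rm i; have ir : (i' < r)%N := ltn_ord i.
have close := singular_vectors_close ir.
have Krow := orthogonal_row_sqr (w i') (orthogonal_K svdH svdHd).
have Lcol := orthogonal_col_sqr i' (orthogonal_L svdH svdHd).
rewrite -/K -/L in Krow Lcol.
(* With the analogue for L, each off-diagonal pair satisfies k_ij^2 + l_ji^2 <= (1 - k_ii^2) + (1 -
   l_ii^2). *)
have K1 (k : 'I_n) : k != w i' -> K (w i') (w i') ^+ 2 + K (w i') k ^+ 2 <= 1.
  move=> ki; rewrite -Krow (bigD1 (w i'))//= (bigD1 k)//= addrA lerDl.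
  by apply: sumr_ge0 => l _; exact: sqr_ge0.
have L1 (k : 'I_m) : k != i' -> L i' i' ^+ 2 + L k i' ^+ 2 <= 1.
  move=> ki; rewrite -Lcol (bigD1 i')//= (bigD1 k)//= addrA lerDl.
  by apply: sumr_ge0 => l _; exact: sqr_ge0.
apply: (row_error_bound (k := fun j => K (w i') (w j)) (l := fun j => L j i')
         (g := fun j : 'I_m => gamma j) (i := i')) => //.
- exact: s0.
- by move=> j; exact: svd_ge0 svdH.
- rewrite -Krow (bigD1 (w i'))//= lerDl.
  by apply: sumr_ge0 => l _; exact: sqr_ge0.
- rewrite -Lcol (bigD1 i')//= lerDl.
  by apply: sumr_ge0 => l _; exact: sqr_ge0.
- have := hrho ir; rewrite /=; lra.
- exact: singular_vectors_same_sign.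
- move=> j ji; have := L1 j ji; have := K1 (w j) ji; lra.
Qed.

End Alignment.

(** * The three estimators and the conclusion *)

Lemma W_rMMSE_rect_diag (R : realType) n m (hmn : (m <= n)%N) (eps : R) U sigma V r :
  0 < eps -> W_rMMSE eps U sigma V r =
  V *m rect_diag m n (fun i => if (i < r)%N then sigma i / (sigma i ^+ 2 + eps) else 0)
    *m U^T :> 'M[R]_(m, n).
Proof.
move=> eps0; rewrite /W_rMMSE -!mulmxA (mulmxA _^T) rect_diag_ridge_inv//.
rewrite (mulmxA (pid_mx r)); congr (V *m (_ *m _)).
have -> : pid_mx r = rect_diag m m (fun i => (i < r)%:R : R).
  by apply/matrixP => i j; rewrite !mxE; case: eqP.
apply/matrixP => i j; rewrite (mul_rect_diag_wide (leqnn m)) !mxE/=.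
by case: (_ == _ :> nat); case: (i < r)%N; rewrite ?mulr0 ?mul0r ?mul1r.
Qed.

Lemma W_MMSE_rect_diag (R : realType) n m (hmn : (m <= n)%N) (eps : R) U sigma V :
  0 < eps -> W_MMSE eps U sigma V =
  V *m rect_diag m n (fun i => sigma i / (sigma i ^+ 2 + eps)) *m U^T :> 'M[R]_(m, n).
Proof.
by move=> eps0; rewrite /W_MMSE -(mulmxA V) rect_diag_ridge_inv.
Qed.

Theorem theorem1 (R : realType) (n m r : nat) (hmn : (m <= n)%N)
    (H dH : 'M[R]_(n, m)) (rkH : \rank H = m) (rkHd : \rank (H + dH)%R = m)
    (M U : 'M[R]_n) (N V : 'M[R]_m) (gamma sigma : nat -> R)
    (svdH : is_svd H M gamma N) (svdHd : is_svd (H + dH) U sigma V)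
    (gamma_decr : forall i j, (i < j)%N -> (j < m)%N -> gamma j < gamma i)
    (gamma_gt0 : forall i, (i < m)%N -> 0 < gamma i)
    (sigma_decr : forall i j, (i < j)%N -> (j < m)%N -> sigma j < sigma i)
    (sigma_gt0 : forall i, (i < m)%N -> 0 < sigma i)
    (eps : R) (eps_gt0 : 0 < eps)
    (d : measure_display) (T : measurableType d) (P : probability T R)
    (X : 'I_m -> {RV P >-> R}) (Z : 'I_n -> {RV P >-> R})
    (stdX : standardized X) (stdZ : standardized Z) (uncXZ : uncorrelated X Z)
    (kappa : R)
    (hpair : corresponding_pair m r kappa eps (spectral_norm dH) gamma sigma)
    (hrho : forall i, (i < r)%N ->
       1 / 2 < rho (spectral_norm dH) gamma sigma i) :
  let rho_ i := rho (spectral_norm dH) gamma sigma i in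
  let x i := sigma i / (sigma i ^+ 2 + eps) in
  let K := U^T *m M in
  let L := N^T *m V in
  let J := mse H eps X Z in
  [/\ `|J (W_rMMSE eps U sigma V r) - J0_rMMSE m r eps gamma sigma|
        <= 2 * (\sum_(i < r) \sum_(j < m)
                  (1 - rho_ i) * (x i * gamma j + 1) ^+ 2),
      `|J (W_rSVD U sigma V r) - J0_rSVD m r eps gamma sigma|
        <= 2 * (\sum_(i < r) \sum_(j < m)
                  (1 - rho_ i) * ((sigma i)^-1 * gamma j + 1) ^+ 2)
    & m%:R - r%:R
        <= \sum_(i < m | (r <= i)%N) \sum_(j < m)
             (x i * gamma j * K (widen_ord hmn i) (widen_ord hmn j) - L j i) ^+ 2
           + eps * (\sum_(i < m | (r <= i)%N) x i ^+ 2) ->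
      J (W_rMMSE eps U sigma V r) <= J (W_MMSE eps U sigma V)].
Proof.
move=> rho_ x K L J.
have [_ /andP[_ /ltnW rm] _ _ _] := hpair.
have [oU oV _ _ _] := svdHd.
have eps_ge0 := ltW eps_gt0.
have lt_m i : (i < r)%N -> (i < m)%N by move=> ir; exact: leq_trans rm.
have x_ge0 i : (i < r)%N -> 0 <= x i.
  by move=> /lt_m/sigma_gt0 s0; rewrite divr_ge0 ?addr_ge0 ?sqr_ge0 ?ltW.
have sum1 : \sum_(i < r) (1 : R) = r%:R by rewrite sumr_const card_ord.
have bound := mse_truncated_error hmn svdH svdHd hpair hrho eps_ge0 stdX stdZ uncXZ.
split.
- rewrite /J (W_rMMSE_rect_diag hmn)//.
  (* Completing the square: r of the m units are moved into the sum, one per index. *)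
  have -> : J0_rMMSE m r eps gamma sigma =
    \sum_(i < r) ((x i * gamma i - 1) ^+ 2 + eps * x i ^+ 2) + (m%:R - r%:R).
    rewrite /J0_rMMSE -sum1 mulr_sumr -sumrB [m%:R - _]addrC addrA -sumrB.
    by congr (_ + _); apply: eq_bigr => i _; rewrite -/(x i); ring.
  exact: (bound x).
- have -> : J0_rSVD m r eps gamma sigma =
    \sum_(i < r) (((sigma i)^-1 * gamma i - 1) ^+ 2 + eps * (sigma i)^-1 ^+ 2)
      + (m%:R - r%:R).
    rewrite /J0_rSVD -sum1 mulr_sumr -sumrB [m%:R - _]addrC addrA -sumrB.
    congr (_ + _); apply: eq_bigr => i _.
    have : sigma i != 0 by rewrite gt_eqF ?sigma_gt0 ?lt_m.
    by move=> s0; field.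
  apply: (bound (fun i => (sigma i)^-1)) => i ir.
  by rewrite invr_ge0 ltW ?sigma_gt0 ?lt_m.
- move=> tail; rewrite /J (W_rMMSE_rect_diag hmn)// (W_MMSE_rect_diag hmn)//.
  rewrite (mse_truncated hmn svdH svdHd _ _ _ _ rm)// (mse_svd hmn _ svdH)//.
  (* The rows i < r of the two estimators coincide, so only the tail is compared with m - r. *)
  rewrite (big_widen rm); apply: lerD; last by rewrite big_split/= -mulr_sumr.
  exact: lexx.
Qed.
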